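(* Let $(W,S)$ be a finite irreducible Coxeter system, $N$ the length of its longest element $w_\circ$, $p=p_1\cdots p_m\in S^m$ a word, and $\mathbf{A}\in\mathbb{R}^{(m-N)\times m}$. If $\mathbf{A}$ is a chirotopal realization of the subword complex $\Delta_W(p)$, then there exist a parameter tensor $\mathcal{P}_{\mathbf{A}}=(p^i{}_{s,k})_{(i,s,k)\in[N]\times S\times\{0,\dots,d-1\}}$ (for some $d\ge1$) and $m$ real numbers $x_i>0$, $i\in[m]$, such that (i) $i<j$ and $p_i=p_j$ implies $x_i<x_j$, and (ii) for every occurrence $\{z_1<\dots<z_N\}\subseteq[m]$ in $p$ of each reduced word $v=p_{z_1}\cdots p_{z_N}$ of $w_\circ$ which is a subword of $p$, the following equality holds: \[ \operatorname{sign}\Big(\sum_{\mathfrak{z}\in\mathfrak{Z}_{\alpha_v}}\det[\mathcal{P}_{\mathbf{A}}]_{\mathfrak{z}}\;\mathsf{S}_{\Lambda_{\mathfrak{z}},\Omega_v}(x_{z_1},\dots,x_{z_N})\Big)=\sigma(v)\,\tau(v). \]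
   Context: Setting. $S=\{s_1<\dots<s_n\}$; $\mathcal{R}(w_\circ)$ is the set of reduced words of $w_\circ$ (words of length $N$ in $S$ representing $w_\circ$); $(m_{i,j})$ is the Coxeter matrix. An occurrence of a word $v=v_1\cdots v_N$ in $p$ is a set of positions $z_1<\dots<z_N$ with $p_{z_1}\cdots p_{z_N}=v$. Subword complex. $\Delta_W(p)$ is the simplicial complex on $[m]$ whose facets are the complements in $[m]$ of the occurrences in $p$ of reduced words of $w_\circ$. Chirotopal realization. Let $\mathbf{A}\in\mathbb{R}^{(m-N)\times m}$ be a vector configuration of maximal rank $m-N$ (columns labeled by $[m]$). A Gale transform of $\mathbf{A}$ is a matrix $\mathbf{B}\in\mathbb{R}^{N\times m}$ of rank $N$ whose row span equals the right kernel of $\mathbf{A}$. For a facet $C$ of $\Delta_W(p)$, its dual simplicial cone is the cone spanned by the columns of $\mathbf{B}$ indexed by $[m]\setminus C$. $\mathbf{A}$ is a chirotopal realization of $\Delta_W(p)$ if, for a Gale transform $\mathbf{B}$ of $\mathbf{A}$: (B) for every facet $C$ the columns of $\mathbf{B}$ indexed by $[m]\setminus C$ are linearly independent; (F) whenever two facets intersect along a ridge (a common codimension-one face), the interiors of their dual simplicial cones intersect. Signs. The $S$-sign of a word $v$ is $\sigma(v)=(-1)^{\operatorname{inv}(v)}$, where $\operatorname{inv}(v)$ is the number of pairs $a<b$ with $v_b<v_a$. The $T$-sign function $\tau:\mathcal{R}(w_\circ)\to\{\pm1\}$ is the function satisfying $\tau(w)=(-1)^{m_{i,j}-1}\tau(w')$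 whenever $w,w'$ are related by a braid move of length $m_{i,j}$ (replacing a factor $s_is_js_i\cdots$ of length $m_{i,j}$ by $s_js_is_j\cdots$ of the same length); it exists and is unique up to a global sign, which is fixed by requiring $\tau=+1$ on the lexicographically first reduced word of $w_\circ$ occurring as a subword in $(s_1\cdots s_n)^\infty$. The product $\sigma(v)\tau(v)$ is called the punctual sign of $v$. Parameter tensor and minors. A parameter tensor is a real array $\mathcal{P}=(p^i{}_{s,k})$ with $(i,s,k)\in[N]\times S\times\{0,\dots,d-1\}$, regarded as an $N\times nd$ matrix with rows indexed by $i$ and columns indexed by pairs $(s,k)$ in lexicographic order. For $v=v_1\cdots v_N$ let $\{v\}_i:=\{j\in[N]:v_j=s_i\}$, $c_i:=\#\{v\}_i$, $\alpha_v:=(c_1,\dots,c_n)$ and $\Omega_v:=(\{v\}_1,\dots,\{v\}_n)$. $\mathfrak{Z}_{\alpha_v}$ is the collection of subsets $\mathfrak{z}\subseteq S\times\{0,\dots,d-1\}$ containing exactly $c_i$ elements with first coordinate $s_i$ for every $i\in[n]$. $[\mathcal{P}]_{\mathfrak{z}}$ is the $N\times N$ submatrix of $\mathcal{P}$ with columns $\mathfrak{z}$ in increasing lexicographic order. $\Lambda_{\mathfrak{z}}=(\lambda^{\mathfrak{z},1},\dots,\lambda^{\mathfrak{z},n})$, where $\lambda^{\mathfrak{z},i}$ is obtained by listing the second coordinates of the elements of $\mathfrak{z}$ with first coordinate $s_i$ in decreasing order and subtracting $c_i-j$ from the entry at position $j$. Schur functions. For a partition $\lambda=(\lambda_1\ge\dots\ge\lambda_r\ge0)$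 and an ordered index set $J$ with $\#J=r$, $\mathsf{s}_{\lambda,J}$ is the polynomial \[\mathsf{s}_{\lambda,J}:=\frac{\det\big(y_j^{\,i-1+\lambda_{r-i+1}}\big)_{(i,j)\in[r]\times J}}{\det\big(y_j^{\,i-1}\big)_{(i,j)\in[r]\times J}}.\] The partial Schur function in variables $y_1,\dots,y_N$ is $\mathsf{S}_{\Lambda_{\mathfrak{z}},\Omega_v}(y_1,\dots,y_N):=\prod_{i=1}^n\mathsf{s}_{\lambda^{\mathfrak{z},i},\{v\}_i}$. *)

(* Defs.v *)
From HB Require Import structures.
From mathcomp Require Import all_boot all_order all_algebra all_fingroup.
From mathcomp Require Import classical_sets reals topology normedtype.
From mathcomp Require Import -(notations) mpoly.

Set Implicit Arguments.
Unset Strict Implicit.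
Unset Printing Implicit Defensive.

Import Order.TTheory GRing.Theory Num.Theory.
Import numFieldNormedType.Exports.

Local Open Scope ring_scope.

(* Letters are indices in 'I_n, ordered as s_1 < ... < s_n, and the generators
   are given by s : 'I_n -> W.  The Coxeter matrix is the matrix of the orders
   of the products s_i s_j. *)

Section Coxeter.

Variables (n : nat) (W : finGroupType) (s : 'I_n -> W).

Definition coxeter_mx (i j : 'I_n) : nat := #[s i * s j]%g.

Definition word_prod (u : seq 'I_n) : W := (\prod_(i <- u) s i)%g.

Record coxeter_system : Prop := CoxeterSystem {
  cox_inj : injective s;
  cox_invol : forall i, #[s i]%g = 2%N;
  cox_gen : forall w : W, exists u : seq 'I_n, word_prod u = w;
  cox_pres : forall (G : groupType) (f : 'I_n -> G),
    (forall i j, ((f i * f j) ^+ coxeter_mx i j)%g = 1%g) ->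
    exists2 phi : W -> G, {morph phi : x y / (x * y)%g}
                        & forall i, phi (s i) = f i }.

(* The Coxeter graph is nonempty and connected. *)
Definition coxeter_irreducible : Prop :=
  (0 < n)%N /\
  forall i j, connect (fun a b => (2 < coxeter_mx a b)%N) i j.

(* A shortest word for w has pairwise distinct prefix products, so
   the search below #|W| succeeds as soon as s generates W. *)
Definition cox_length (w : W) : nat :=
  find (fun k => [exists u : k.-tuple 'I_n, word_prod u == w]) (iota 0 #|W|).

Definition longest_element : W := [arg max_(w > 1%g) cox_length w].

Definition longest_length : nat := cox_length longest_element.

Definition reduced_w0 (u : seq 'I_n) : bool :=
  (size u == longest_length) && (word_prod u == longest_element).

Definition alternating_word (i j : 'I_n) (k : nat) : seq 'I_n :=
  mkseq (fun l => if odd l then j else i) k.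

(* The strictly increasing positions z, counted from 0, spell u in the infinite
   word (s_1 ... s_n)^oo, whose letter at position q has index q %% n. *)
Definition spelled_in_cox_power (z : seq nat) (u : seq 'I_n) : Prop :=
  sorted ltn z /\ [seq (q %% n)%N | q <- z] = [seq val i | i <- u].

(* Subwords are compared lexicographically through their positions. *)
Definition first_reduced_w0 (u : seq 'I_n) : Prop :=
  reduced_w0 u /\
  exists2 z, spelled_in_cox_power z u &
    forall z' u', reduced_w0 u' -> spelled_in_cox_power z' u' ->
      ((z : seqlexi nat) <= (z' : seqlexi nat))%O.

(* Only the values of tau on reduced words of w_0 are meaningful. *)
Record T_sign (tau : seq 'I_n -> int) : Prop := TSign {
  T_sign_pm1 : forall u, reduced_w0 u -> tau u = 1 \/ tau u = -1;
  T_sign_braid : forall (i j : 'I_n) (a b : seq 'I_n), i != j ->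
    let w := a ++ alternating_word i j (coxeter_mx i j) ++ b in
    let w' := a ++ alternating_word j i (coxeter_mx i j) ++ b in
    reduced_w0 w -> reduced_w0 w' ->
    tau w = (-1) ^+ (coxeter_mx i j).-1 * tau w';
  T_sign_first : forall u, first_reduced_w0 u -> tau u = 1 }.

End Coxeter.

Definition inv_number (n N : nat) (v : N.-tuple 'I_n) : nat :=
  #|[set ab : 'I_N * 'I_N |
      (ab.1 < ab.2)%N && (tnth v ab.2 < tnth v ab.1)%N]|.

Definition S_sign (n N : nat) (v : N.-tuple 'I_n) : int :=
  (-1) ^+ inv_number v.

Section SubwordComplex.

Variables (n : nat) (W : finGroupType) (s : 'I_n -> W).
Variables (m : nat) (p : m.-tuple 'I_n).

(* enum lists the positions in Z in increasing order. *)
Definition subword (Z : {set 'I_m}) : seq 'I_n := [seq tnth p i | i <- enum Z].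

Definition subword_complex : {set {set 'I_m}} :=
  [set F : {set 'I_m} |
    [exists C : {set 'I_m}, reduced_w0 s (subword (~: C)) && (F \subset C)]].

End SubwordComplex.

Section Chirotope.

Variable R : realType.

Definition facet (m : nat) (K : {set {set 'I_m}}) (C : {set 'I_m}) : bool :=
  maxset (mem K) C.

Definition share_ridge (m : nat) (C D : {set 'I_m}) : Prop :=
  #|C :&: D|.+1 = #|C| /\ #|C :&: D|.+1 = #|D|.

(* The rows of kermx A^T span the space of all u such that A *m u^T = 0. *)
Definition gale_transform (N m : nat) (A : 'M[R]_(m - N, m)) (B : 'M[R]_(N, m))
  : Prop := \rank B = N /\ (B == kermx A^T)%MS.

Definition dual_cone (N m : nat) (B : 'M[R]_(N, m)) (C : {set 'I_m})
  : set 'cV[R]_N :=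
  fun y => exists2 a : 'I_m -> R, (forall j, 0 <= a j)
                                & y = \sum_(j in ~: C) a j *: col j B.

Definition chirotopal_realization (N m : nat) (K : {set {set 'I_m}})
    (A : 'M[R]_(m - N, m)) : Prop :=
  \rank A = (m - N)%N /\
  exists B : 'M[R]_(N, m),
    [/\ gale_transform A B,
        forall C, facet K C ->
          row_free (colsub (fun j : 'I_#|~: C| => enum_val j) B)^T
      & forall C D, facet K C -> facet K D -> share_ridge C D ->
          exists y, interior (dual_cone B C) y /\ interior (dual_cone B D) y].

End Chirotope.

Section Alternants.

Variable K : comNzRingType.

Definition alternant (r : nat) (y : 'I_r -> K) (e : 'I_r -> nat) : K :=
  \det (\matrix_(i < r, j < r) y j ^+ e i).

Lemma newton_expansion (y : nat -> K) (f : {poly K}) (k : nat) :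
  exists (c : nat -> K) (g : {poly K}),
    f = \sum_(l < k) c l *: \prod_(h < l) ('X - (y h)%:P)
        + g * \prod_(h < k) ('X - (y h)%:P).
Proof.
elim: k => [|k [c [g ->]]].
  by exists (fun=> 0), f; rewrite !big_ord0 add0r mulr1.
have /factor_theorem[q Dq]: root (g - (g.[y k])%:P) (y k).
  by rewrite rootE !hornerE subrr.
exists (fun l => if l == k then g.[y k] else c l), q.
rewrite !big_ord_recr /= eqxx -addrA; congr (_ + _).
  by apply: eq_bigr => l _; rewrite ltn_eqF.
rewrite [_ * ('X - _)]mulrC mulrA -Dq mulrBl mul_polyC.
by rewrite addrC subrK.
Qed.

Lemma alternant_dvd (r : nat) (y : 'I_r -> K) (e : 'I_r -> nat) :
  exists q : K, q * alternant y (fun i => i) = alternant y e.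
Proof.
pose y' l := if insub l is Some j then y j else 0.
have y'E (j : 'I_r) : y' j = y j by rewrite /y' valK.
pose T : 'M[K]_r := \matrix_(k, j) \prod_(h < k) (y j - y' h).
have DV : alternant y (fun i => i) = \det T.
  pose a : 'rV[K]_r := \row_j y j.
  have -> : alternant y (fun i => i) = \det (Vandermonde r a).
    by congr (\det _); apply/matrixP => i j; rewrite !mxE.
  rewrite det_Vandermonde -det_tr det_trig; last first.
    apply/is_trig_mxP => j k ltjk; rewrite !mxE.
    by rewrite (bigD1 (Ordinal ltjk)) //= y'E subrr mul0r.
  rewrite (exchange_big_dep predT) //=; apply: eq_bigr => j _; rewrite !mxE.
  rewrite (big_ord_widen r (fun h => y j - y' h)) ?(ltnW (ltn_ord j)) //.
  by apply: eq_bigr => h _; rewrite !mxE y'E.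
have /fin_all_exists[c Dc] : forall i : 'I_r, exists c : nat -> K,
    forall j : 'I_r, y j ^+ e i = \sum_(k < r) c k * T k j.
  move=> i; have [c [g Dg]] := newton_expansion y' 'X^(e i) r.
  exists c => j; rewrite -hornerXn Dg hornerD hornerM.
  have -> : (\prod_(h < r) ('X - (y' h)%:P)).[y j] = 0.
    by rewrite horner_prod (bigD1 j) //= !hornerE y'E subrr mul0r.
  rewrite mulr0 addr0 horner_sum; apply: eq_bigr => k _; rewrite hornerZ mxE horner_prod.
  by congr (_ * _); apply: eq_bigr => h _; rewrite !hornerE.
exists (\det (\matrix_(i, k) c i k)); rewrite DV -det_mulmx.
congr (\det _); apply/matrixP => i j; rewrite !mxE Dc.
by apply: eq_bigr => k _; rewrite !mxE.
Qed.

End Alternants.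

Section PartialSchur.

Variables (R : idomainType) (N : nat).

(* For r = #|J|, row i (counted from 0) of the numerator has exponents
   i + lambda_{r-i}, with lambda_{r-i} = nth 0 lam (r - i.+1). *)
Definition schur_num (lam : seq nat) (J : {set 'I_N}) : mpoly N R :=
  alternant (fun j : 'I_#|J| => mpolyX R (mnm1 (enum_val j)))
            (fun i => (i + nth 0 lam (#|J| - i.+1))%N).

Definition schur_den (J : {set 'I_N}) : mpoly N R :=
  alternant (fun j : 'I_#|J| => mpolyX R (mnm1 (enum_val j))) (fun i => i).

Lemma schur_exists (lam : seq nat) (J : {set 'I_N}) :
  exists q : mpoly N R, q * schur_den J == schur_num lam J.
Proof.
by have [q Dq] := alternant_dvd
  (fun j : 'I_#|J| => mpolyX R (mnm1 (enum_val j)))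
  (fun i => (i + nth 0 lam (#|J| - i.+1))%N); exists q; apply/eqP.
Qed.

(* The quotient schur_num / schur_den, as a polynomial. *)
Definition schur (lam : seq nat) (J : {set 'I_N}) : mpoly N R :=
  xchoose (schur_exists lam J).

Definition partial_schur (n : nat) (Lam : 'I_n -> seq nat)
    (Om : 'I_n -> {set 'I_N}) : mpoly N R :=
  \prod_(i < n) schur (Lam i) (Om i).

End PartialSchur.

Section Minors.

Variables (n N d : nat).

Definition letter_positions (v : N.-tuple 'I_n) (i : 'I_n) : {set 'I_N} :=
  [set j | tnth v j == i].

Definition abelian_vector (v : N.-tuple 'I_n) (i : 'I_n) : nat :=
  #|letter_positions v i|.

Definition column_sets (al : 'I_n -> nat) : {set {set 'I_n * 'I_d}} :=
  [set z : {set 'I_n * 'I_d} |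
    [forall i, #|[set k : 'I_d | (i, k) \in z]| == al i]].

(* enum lists the pairs in z in lexicographic order. *)
Definition param_submx (R : realType) (P : 'I_N -> 'I_n -> 'I_d -> R)
    (z : {set 'I_n * 'I_d}) : 'M[R]_N :=
  \matrix_(i < N, j < N) nth 0 [seq P i sk.1 sk.2 | sk <- enum z] j.

(* Positions are counted from 0, so that the entry at j loses c_i - (j + 1). *)
Definition column_partition (z : {set 'I_n * 'I_d}) (i : 'I_n) : seq nat :=
  let L := rev [seq val k | k <- enum [set k : 'I_d | (i, k) \in z]] in
  mkseq (fun j => nth 0 L j - (size L - j.+1))%N (size L).

(* The sum over Z_{alpha_v} of det [P]_z times the partial Schur function of z
   and v, evaluated at y. *)
Definition schur_minor_sum (R : realType) (P : 'I_N -> 'I_n -> 'I_d -> R)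
    (v : N.-tuple 'I_n) (y : 'I_N -> R) : R :=
  \sum_(z in column_sets (abelian_vector v))
    \det (param_submx P z) *
    meval y (partial_schur R (column_partition z) (letter_positions v)).

End Minors.

(* Main.v *)
(* Choose distinct positive x_j increasing in j and interpolate each row of a Gale
   transform B at all the x_j by one polynomial; its coefficients give P.  By
   Cauchy--Binet, the maximal minor of B at an occurrence of v is the Schur sum
   times sigma(v) (sorting the columns by letter makes the generalized
   Vandermonde factors block diagonal) times positive Vandermonde determinants.
   It remains to see that the sign of this minor is tau(v), up to a global sign
   that is absorbed in the first row of P.  A flip moves one column past k others,
   so condition (F) makes the minor change sign by (-1)^k; tau changes in the same
   way by the dihedral case and induction on k, and flips connect all occurrences
   by the exchange condition. *)
Require Import Defs.
From mathcomp Require Import classical_sets reals topology normedtype.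
From mathcomp Require Import all_boot all_order all_algebra all_fingroup cyclic.
From mathcomp Require Import -(notations) mpoly.

Set Implicit Arguments.
Unset Strict Implicit.
Unset Printing Implicit Defensive.

Local Open Scope ring_scope.

Import Order.TTheory GRing.Theory Num.Theory.
Import numFieldNormedType.Exports.

(** * Exchange, Matsumoto's theorem and the T-sign *)

Section CoxeterWords.

Variables (n : nat) (W : finGroupType) (s : 'I_n -> W).

Local Notation wp := (word_prod s).
Local Notation mx := (coxeter_mx s).

Lemma word_prod_nil : wp [::] = 1%g.
Proof. by rewrite /word_prod big_nil. Qed.

Lemma word_prod_cons i u : wp (i :: u) = (s i * wp u)%g.
Proof. by rewrite /word_prod big_cons. Qed.

Lemma word_prod_cat u v : wp (u ++ v) = (wp u * wp v)%g.
Proof. by rewrite /word_prod big_cat. Qed.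

Lemma alternating_wordS (i j : 'I_n) k :
  alternating_word i j k.+1 = i :: alternating_word j i k.
Proof.
rewrite /alternating_word /mkseq /= -[1%N]/(1 + 0)%N iotaDl -map_comp.
by congr (_ :: _); apply: eq_map => l /=; case: (odd l).
Qed.

Lemma size_alternating_word (i j : 'I_n) k : size (alternating_word i j k) = k.
Proof. exact: size_mkseq. Qed.

Lemma alternating_word_rcons (i j : 'I_n) k :
  alternating_word i j k.+1 =
  alternating_word i j k ++ [:: if odd k then j else i].
Proof.
by rewrite /alternating_word /mkseq -[k.+1]addn1 iotaD map_cat.
Qed.

Hypothesis cox : coxeter_system s.

Lemma mul_ss i : (s i * s i)%g = 1%g.
Proof. by rewrite -expg2 -(cox_invol cox i) expg_order. Qed.

Lemma inv_s i : ((s i)^-1)%g = s i.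
Proof. by apply/eqP; rewrite eq_invg_mul mul_ss. Qed.

Lemma mul_sK i x : (s i * (s i * x))%g = x.
Proof. by rewrite mulgA mul_ss mul1g. Qed.

Lemma coxeter_mxC i j : mx i j = mx j i.
Proof. by rewrite /coxeter_mx -orderV invMg !inv_s. Qed.

Lemma coxeter_mx_ge2 i j : i != j -> (1 < mx i j)%N.
Proof.
move=> ij; rewrite ltn_neqAle order_gt0 andbT eq_sym order_eq1.
apply: contraNneq ij => /(canRL (mulKg _)).
by rewrite mulg1 inv_s => /(cox_inj cox) ->.
Qed.

(* The parity of the number of k such that t is the reflection
   s_1 ... s_k ... s_1 attached to the k-th letter of u. *)
Fixpoint inversion_parity (u : seq 'I_n) (t : W) : bool :=
  if u is i :: u' then (t == s i) (+) inversion_parity u' (t ^ s i)%g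
  else false.

Lemma inversion_parity_cat u v t :
  inversion_parity (u ++ v) t =
  inversion_parity u t (+) inversion_parity v (t ^ wp u)%g.
Proof.
elim: u t => [|i u IHu] t /=; first by rewrite word_prod_nil conjg1.
by rewrite IHu word_prod_cons conjgM addbA.
Qed.

(** The signed-reflection action of a Coxeter group, taken on all of [W * bool] so that no set of
    reflections has to be singled out. *)
Definition reflection_step_fun (i : 'I_n) (x : W * bool) : W * bool :=
  ((x.1 ^ s i)%g, x.2 (+) (x.1 == s i)).

Lemma reflection_step_inj i : injective (reflection_step_fun i).
Proof.
move=> [t e] [t' e'] [/conjg_inj <-] /(can_inj (addbK _)) <- //.
Qed.

Definition reflection_step i : {perm (W * bool)} := perm (@reflection_step_inj i).

Lemma reflection_step_word u t e :
  (\prod_(i <- u) reflection_step i)%g (t, e) =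
  ((t ^ wp u)%g, e (+) inversion_parity u t).
Proof.
elim: u t e => [|i u IHu] t e.
  by rewrite big_nil perm1 word_prod_nil conjg1 addbF.
by rewrite big_cons permM permE IHu word_prod_cons conjgM addbA.
Qed.

(** Conjugating (s_j s_i)^l s_j by s_i gives (s_i s_j)^(l+1) s_i, so these elements are the
    reflections attached to the successive letters. *)
Lemma inversion_parity_alternating i j k t :
  inversion_parity (alternating_word i j k) t =
  \big[addb/false]_(l < k) (t == (s i * s j) ^+ l * s i)%g.
Proof.
elim: k i j t => [|k IHk] i j t; first by rewrite big_ord0.
rewrite alternating_wordS /= big_ord_recl expg0 mul1g IHk.
congr (_ (+) _); apply: eq_bigr => l _.
rewrite -(inj_eq (@conjg_inj _ (s i))) -conjgM mul_ss conjg1.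
congr (_ == _); rewrite conjgE inv_s lift0.
have comm_exp : (s i * (s j * s i) ^+ l = (s i * s j) ^+ l * s i)%g.
  elim: (nat_of_ord l) => [|q IHq]; first by rewrite !expg0 mulg1 mul1g.
  by rewrite expgSr mulgA IHq expgSr !mulgA.
by rewrite expgSr !mulgA comm_exp.
Qed.

(** In the relation word of length 2m, the reflections at letters l and l + m coincide because (s_i
    s_j)^m = 1; each is counted an even number of times. *)
Lemma inversion_parity_relation i j t :
  inversion_parity (alternating_word i j (mx i j + mx i j)) t = false.
Proof.
rewrite inversion_parity_alternating big_split_ord /=.
under [X in _ (+) X]eq_bigr => l _ do rewrite expgD expg_order mul1g.
exact: addbb.
Qed.

Lemma word_prod_alternating i j k :
  wp (alternating_word i j (k + k)) = ((s i * s j) ^+ k)%g.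
Proof.
elim: k => [|k IHk]; first by rewrite word_prod_nil.
by rewrite addSn addnS !alternating_wordS !word_prod_cons IHk expgS mulgA.
Qed.

Lemma reflection_step_relation i j :
  ((reflection_step i * reflection_step j) ^+ mx i j)%g = 1%g.
Proof.
have alt_prod k : (\prod_(l <- alternating_word i j (k + k)) reflection_step l)%g
    = ((reflection_step i * reflection_step j) ^+ k)%g.
  elim: k => [|k IHk]; first by rewrite big_nil.
  by rewrite addSn addnS !alternating_wordS !big_cons IHk expgS mulgA.
apply/permP => -[t e]; rewrite -alt_prod reflection_step_word perm1.
by rewrite word_prod_alternating expg_order conjg1 inversion_parity_relation addbF.
Qed.

(* The presentation makes W act on W * bool, and this action records
   the parity of each reflection. *)
Lemma inversion_parity_wd u v t :
  wp u = wp v -> inversion_parity u t = inversion_parity v t.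
Proof.
move=> uv; have [phi phiM phiE] := cox_pres cox reflection_step_relation.
have phi1 : phi 1%g = 1%g.
  by apply: (mulgI (phi 1%g)); rewrite -phiM !mulg1.
have phi_word w : phi (wp w) = (\prod_(i <- w) reflection_step i)%g.
  by rewrite /word_prod (big_morph phi phiM phi1); apply: eq_bigr.
have := congr1 (fun q : {perm W * bool} => (q (t, false)).2) (congr1 phi uv).
by rewrite /= !phi_word !reflection_step_word /= .
Qed.

(** Odd parity means that [t] is attached to some letter, and left multiplication by the reflection
    attached to a letter deletes that letter. *)
Lemma inversion_parity_exchange u t : inversion_parity u t ->
  exists2 k, (k < size u)%N & (t * wp u)%g = wp (take k u ++ drop k.+1 u).
Proof.
elim: u t => [|i u IHu] //= t; case: eqP => [-> _|_ /= /IHu[k ltk Dk]].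
  by exists 0; rewrite // word_prod_cons mul_sK take0 /= drop0.
exists k.+1 => //=; rewrite !word_prod_cons -Dk conjgE inv_s.
by rewrite !mulgA mul_ss mul1g.
Qed.

(** * Reduced words and the exchange condition *)

Definition reduced u := forall v, wp v = wp u -> (size u <= size v)%N.

Lemma reduced_catl u v : reduced (u ++ v) -> reduced u.
Proof.
move=> red w wu; have := red (w ++ v); rewrite !word_prod_cat wu => /(_ erefl).
by rewrite !size_cat leq_add2r.
Qed.

Lemma reduced_catr u v : reduced (u ++ v) -> reduced v.
Proof.
move=> red w wv; have := red (u ++ w); rewrite !word_prod_cat wv => /(_ erefl).
by rewrite !size_cat leq_add2l.
Qed.

Lemma reduced_eq u v : reduced u -> wp v = wp u -> size v = size u -> reduced v.
Proof. by move=> red vu sz w wv; rewrite sz; apply: red; rewrite wv. Qed.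

Lemma reduced_size u v : reduced u -> reduced v -> wp u = wp v -> size u = size v.
Proof. by move=> ru rv uv; apply/eqP; rewrite eqn_leq ru ?rv. Qed.

Lemma size_delete (T : Type) k (u : seq T) :
  (k < size u)%N -> (size (take k u ++ drop k.+1 u)).+1 = size u.
Proof.
move=> ltk; rewrite size_cat size_takel ?(ltnW ltk) // size_drop -addnS.
by rewrite -subSn //= subSS subnKC // ltnW.
Qed.

(** The first letter contributes s_i once. If the tail had odd parity at s_i as well, deleting a
    letter there would give a shorter word for the same element. *)
Lemma reduced_head_parity i u : reduced (i :: u) -> inversion_parity (i :: u) (s i).
Proof.
move=> red /=; rewrite eqxx conjgE mul_ss mulg1 inv_s.
apply/negP => /inversion_parity_exchange[k ltk Dk].
have := red (take k u ++ drop k.+1 u); rewrite -Dk word_prod_cons => /(_ erefl).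
by rewrite /= -(size_delete ltk) ltnNge leqnSn.
Qed.

(** The parity at s_i depends only on the product, so it is odd for [v] too and yields a letter of
    [v] to delete. *)
Lemma left_exchange i u v : reduced (i :: u) -> wp v = wp (i :: u) ->
  exists2 k, (k < size v)%N & wp (i :: take k v ++ drop k.+1 v) = wp v.
Proof.
move=> red vu; have := reduced_head_parity red.
rewrite -(inversion_parity_wd _ vu) => /inversion_parity_exchange[k ltk Dk].
by exists k => //; rewrite word_prod_cons -Dk mul_sK.
Qed.

(** An equality s_j = (s_i s_j)^l s_i would give (s_i s_j)^(l+1) = 1 with l + 1 smaller than the
    order. *)
Lemma alternating_parityF i j k : (k < mx i j)%N ->
  inversion_parity (alternating_word i j k) (s j) = false.
Proof.
move=> ltk; rewrite inversion_parity_alternating big1 // => l _.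
apply/negbTE/eqP => Dj; have : ((s i * s j) ^+ l.+1 == 1)%g.
  by rewrite expgSr mulgA -Dj mul_ss.
rewrite -order_dvdn => /dvdn_leq-/(_ isT); rewrite leqNgt.
by rewrite (leq_ltn_trans (ltn_ord l) ltk).
Qed.

(** The word has odd parity at s_j but its alternating prefix does not. The deleted letter therefore
    lies in [x], and putting j in front makes the alternating prefix one letter longer. *)
Lemma alternating_prefix_step i j k x w : (k < mx i j)%N ->
    reduced (j :: w) -> wp (alternating_word i j k ++ x) = wp (j :: w) ->
    size (alternating_word i j k ++ x) = size (j :: w) ->
  exists2 x', wp (alternating_word j i k.+1 ++ x') = wp (j :: w)
            & size (alternating_word j i k.+1 ++ x') = size (j :: w).
Proof.
move=> ltk red xw szx; have := reduced_head_parity red.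
rewrite -(inversion_parity_wd _ xw) inversion_parity_cat alternating_parityF // addFb.
move=> /inversion_parity_exchange[l ltl Dl].
exists (take l x ++ drop l.+1 x).
  rewrite alternating_wordS cat_cons word_prod_cons word_prod_cat -Dl conjgE.
  rewrite -xw word_prod_cat !mulgA; congr (_ * _)%g.
  by rewrite mulgK mul_ss mul1g.
rewrite -szx size_cat [RHS]size_cat !size_alternating_word addSnnS.
by rewrite size_delete.
Qed.

Lemma word_prod_alternating_div i j k :
  (wp (alternating_word i j k) * (wp (alternating_word j i k))^-1)%g =
  ((s i * s j) ^+ k)%g.
Proof.
elim: k i j => [|k IHk] i j; first by rewrite !word_prod_nil mulgV.
rewrite !alternating_wordS !word_prod_cons invMg inv_s -mulgA (mulgA _ _^-1%g).
rewrite IHk; elim: k {IHk} => [|k IHk]; first by rewrite !expg0 mul1g.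
by rewrite [RHS]expgS -IHk expgS !mulgA.
Qed.

Lemma word_prod_braid i j :
  wp (alternating_word i j (mx i j)) = wp (alternating_word j i (mx i j)).
Proof.
apply/eqP; rewrite eq_mulgV1 word_prod_alternating_div.
by rewrite expg_order.
Qed.

(** Alternating prefixes starting with i and with j lengthen each other in turn until both have
    length [mx i j]. The full prefixes have equal products, so one [x] completes both. *)
Lemma alternating_prefix i j u v : i != j ->
    reduced (i :: u) -> reduced (j :: v) -> wp (i :: u) = wp (j :: v) ->
  exists x, [/\ wp (alternating_word i j (mx i j) ++ x) = wp (i :: u),
                wp (alternating_word j i (mx i j) ++ x) = wp (i :: u)
              & (mx i j + size x)%N = (size u).+1].
Proof.
move=> ij redu redv uv; have sz := reduced_size redu redv uv.
have P k : (0 < k <= mx i j)%N ->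
  (exists2 x, wp (alternating_word i j k ++ x) = wp (i :: u)
            & size (alternating_word i j k ++ x) = size (i :: u)) /\
  (exists2 x, wp (alternating_word j i k ++ x) = wp (j :: v)
            & size (alternating_word j i k ++ x) = size (j :: v)).
  elim: k => [|[|k] IHk] // ltk; first by split; [exists u | exists v].
  have [[x wx szx] [y wy szy]] := IHk (ltnW ltk); split.
    apply: (alternating_prefix_step (x := y)) => //; rewrite ?wy ?szy //.
    by rewrite coxeter_mxC.
  by apply: (alternating_prefix_step (x := x)) => //; rewrite ?wx ?szx.
have m_gt0 : (0 < mx i j)%N by apply: order_gt0.
have [[x wx szx] _] := P _ (introT andP (conj m_gt0 (leqnn _))).
exists x; split=> //; last by move: szx; rewrite size_cat size_alternating_word.
rewrite word_prod_cat -wx word_prod_cat; congr (_ * _)%g.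
by rewrite word_prod_braid.
Qed.

Lemma cox_length_le u : (cox_length s (wp u) <= size u)%N.
Proof.
rewrite leqNgt; apply/negP => ltu; have := before_find 0 ltu.
have ltW : (size u < #|W|)%N.
  by rewrite (leq_trans ltu) // (leq_trans (find_size _ _)) ?size_iota.
by rewrite nth_iota // add0n => /existsP[]; exists (in_tuple u).
Qed.

(** A generator has positive length, since the empty word spells 1 and generators have order 2; the
    maximum is at least as large. *)
Lemma longest_length_gt0 : (0 < n)%N -> (0 < longest_length s)%N.
Proof.
move=> n_gt0; pose i := Ordinal n_gt0.
rewrite /longest_length /longest_element.
case: arg_maxnP => // w _ /(_ (s i) isT); apply: leq_trans.
rewrite lt0n; apply/negP => /eqP len0.
have [u] := cox_gen cox (s i); case: u => [|j u].
  move/eqP; rewrite word_prod_nil eq_sym -order_eq1 (cox_invol cox) //.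
move=> _; have W_gt0 : (0 < #|W|)%N by apply/card_gt0P; exists 1%g.
have /(nth_find 0): has (fun k => [exists u : k.-tuple 'I_n, wp u == s i]) (iota 0 #|W|).
  by rewrite has_find size_iota -/(cox_length s (s i)) len0.
rewrite -/(cox_length s (s i)) len0 nth_iota //= => /existsP[x].
rewrite tuple0 word_prod_nil eq_sym -order_eq1 (cox_invol cox) //.
Qed.
Lemma reduced_w0_reduced u : reduced_w0 s u -> reduced u.
Proof.
move=> /andP[/eqP szu /eqP wu] v vu; rewrite szu /longest_length -wu -vu.
exact: cox_length_le.
Qed.

Lemma reduced_w0_eq u v :
  wp u = wp v -> size u = size v -> reduced_w0 s u = reduced_w0 s v.
Proof. by rewrite /reduced_w0 => -> ->. Qed.

Lemma reduced_w0_factor a u b : reduced_w0 s (a ++ u ++ b) -> reduced u.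
Proof. by move/reduced_w0_reduced/reduced_catr/reduced_catl. Qed.

Lemma reduced_w0_replace a u v b : wp u = wp v -> size u = size v ->
  reduced_w0 s (a ++ u ++ b) = reduced_w0 s (a ++ v ++ b).
Proof.
by move=> uv sz; apply: reduced_w0_eq; rewrite ?word_prod_cat ?size_cat ?uv ?sz.
Qed.

(** * The T-sign along braid moves and flips *)

Section TSign.

Variable tau : seq 'I_n -> int.
Hypothesis Htau : T_sign s tau.

(** The sign [e] is chosen before the context [a], [b]. This uniformity makes the relation
    compatible with concatenation and lets one sign serve in two different contexts. *)
Definition T_related (u v : seq 'I_n) :=
  exists e : bool, forall a b, reduced_w0 s (a ++ u ++ b) ->
    tau (a ++ u ++ b) = (-1) ^+ e * tau (a ++ v ++ b).

Lemma T_related_refl u : T_related u u.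
Proof. by exists false => a b _; rewrite mul1r. Qed.

Lemma T_related_trans u v w : wp u = wp v -> size u = size v ->
  T_related u v -> T_related v w -> T_related u w.
Proof.
move=> uv sz [e He] [f Hf]; exists (e (+) f) => a b red.
rewrite He // Hf -?(reduced_w0_replace _ _ uv sz) //.
by rewrite signr_addb mulrA.
Qed.

Lemma T_related_cat a u v b : T_related u v -> T_related (a ++ u ++ b) (a ++ v ++ b).
Proof.
by move=> [e He]; exists e => c d; rewrite -!catA !(catA c); apply: He.
Qed.

Lemma T_related_braid i j : i != j ->
  T_related (alternating_word i j (mx i j)) (alternating_word j i (mx i j)).
Proof.
move=> ij; exists (odd (mx i j).-1) => a b red; rewrite signr_odd.
apply: (T_sign_braid Htau) => //.
by rewrite -(reduced_w0_replace _ _ (word_prod_braid i j)) ?size_alternating_word.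
Qed.

(* Matsumoto's theorem, with the sign carried along. *)
Lemma T_related_reduced u v :
  reduced u -> reduced v -> wp u = wp v -> T_related u v.
Proof.
have [k] := ubnP (size u); elim: k u v => // k IHk u v ltu redu redv uv.
have sz := reduced_size redu redv uv.
case: u => [|i u] in ltu redu uv sz *; case: v => [|j v] in redv uv sz * => //.
  exact: T_related_refl.
have cons_related l x y : reduced (l :: x) -> reduced (l :: y) ->
    (size x < k)%N -> wp (l :: x) = wp (l :: y) -> T_related (l :: x) (l :: y).
  move=> redx redy ltx; rewrite !word_prod_cons => /mulgI xy.
  have H := @T_related_cat [:: l] x y [::]; rewrite !cats0 in H; apply: H.
  by apply: IHk => //; apply: (@reduced_catr [:: l]).
case: (eqVneq i j) => [eij|ij]; first by rewrite -eij in redv uv *; apply: cons_related.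
(* For distinct first letters, the two words are linked through the two alternating prefixes
   followed by [x]. The outer links share a first letter, the middle one is a braid move. *)
have [x [xu xv szx]] := alternating_prefix ij redu redv uv.
have : (0 < mx i j)%N by apply: order_gt0.
have := T_related_braid ij.
have := size_alternating_word i j (mx i j); have := size_alternating_word j i (mx i j).
case: (mx i j) xu xv szx => // q xu xv szx szij szji rel _.
have szx1 : size (alternating_word i j q.+1 ++ x) = size (i :: u).
  by rewrite size_cat szji szx.
have szx2 : size (alternating_word j i q.+1 ++ x) = size (j :: v).
  by rewrite size_cat szij szx -sz.
have red1 := reduced_eq redu xu szx1.
have red2 := reduced_eq redv (etrans xv uv) szx2.
have /T_related_trans : T_related (i :: u) (alternating_word i j q.+1 ++ x).
  by rewrite alternating_wordS in red1 xu *; apply: cons_related.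
apply=> //; have := T_related_cat [::] x rel => /T_related_trans; apply.
- by rewrite /= xu xv.
- by rewrite !size_cat szij szji.
rewrite alternating_wordS in red2 xv *; apply: cons_related => //.
- by rewrite size_cat size_alternating_word; case: szx => ->.
- by rewrite -uv.
Qed.

(** The word i y is rewritten to start with an alternating prefix of length q + 1 = m. The braid
    move there contributes (-1)^q, the remaining flip past [x] contributes (-1)^(size x) by
    induction, and q + size x is the length of y. *)
Lemma T_sign_flip a i y j b :
    wp (i :: y) = wp (y ++ [:: j]) -> reduced_w0 s (a ++ (i :: y) ++ b) ->
  tau (a ++ (i :: y) ++ b) = (-1) ^+ size y * tau (a ++ (y ++ [:: j]) ++ b).
Proof.
have [k] := ubnP (size y); elim: k a i y j b => // k IHk a i y j b lty iyj red0.
have red := reduced_w0_factor red0.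
have redj : reduced (y ++ [:: j]) by apply: reduced_eq red _ _; rewrite // size_cat addn1.
case: y => [|r y] in lty iyj red0 red redj *.
  by move: iyj; rewrite !word_prod_cons word_prod_nil !mulg1 => /(cox_inj cox)->;
    rewrite mul1r.
have ir : i != r.
  apply/eqP => eir; rewrite eir in red; have := red y.
  by rewrite !word_prod_cons mul_sK => /(_ erefl); rewrite ltnNge leqnSn.
have [x [xi xr szx]] := alternating_prefix ir red redj iyj.
have m_gt1 := coxeter_mx_ge2 ir.
have Dm : mx i r = (mx i r).-1.+1 by rewrite prednK // ltnW.
set q := (mx i r).-1 in Dm *; rewrite Dm in xi xr szx.
set z := alternating_word r i q ++ x.
have zy : wp z = wp (r :: y).
  by move: xi; rewrite alternating_wordS cat_cons !word_prod_cons => /mulgI.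
have szz : size z = size (r :: y).
  by apply: succn_inj; rewrite -szx size_cat size_alternating_word.
have redy : reduced (r :: y) by apply: (@reduced_catr [:: i]).
have redz := reduced_eq redy zy szz.
(* The tail is replaced by [z] on both sides of the flip, with the same sign [e], which then
   cancels. *)
have [e He] := T_related_reduced redy redz (esym zy).
have D1 := He (a ++ [:: i]) b; rewrite -!catA !cat1s in D1; rewrite {}D1 //.
have red_yj : reduced_w0 s (a ++ (r :: y) ++ j :: b).
  have := red0; rewrite (reduced_w0_replace _ _ iyj) ?size_cat ?addn1 //.
  by rewrite -catA.
rewrite -[(_ ++ [:: j]) ++ b]catA cat1s [in RHS]He //.
rewrite mulrCA; congr (_ * _).
have red_iz : reduced_w0 s (a ++ alternating_word i r q.+1 ++ x ++ b).
  rewrite alternating_wordS cat_cons catA -/z -cat_cons.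
  have -> := @reduced_w0_replace a (i :: z) (i :: r :: y) b; rewrite ?red0 //.
    by rewrite !(word_prod_cons i) zy.
  by rewrite /= szz.
(* The last letter of the braided prefix is the one that is left to be moved past [x]. *)
set l := if odd q then i else r.
have Dl : alternating_word r i q.+1 = alternating_word r i q ++ [:: l].
  exact: alternating_word_rcons.
have red_ri : reduced_w0 s (a ++ alternating_word r i q.+1 ++ x ++ b).
  rewrite -(@reduced_w0_replace a (alternating_word i r q.+1)) //.
    by rewrite -Dm word_prod_braid.
  by rewrite !size_alternating_word.
have := T_sign_braid Htau (a := a) (b := x ++ b) ir; rewrite Dm.
move=> /(_ red_iz red_ri); rewrite [alternating_word i r _]alternating_wordS.
rewrite cat_cons catA -/z => ->.
have szxy : (q + size x)%N = (size y).+1.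
  by move: szz; rewrite size_cat size_alternating_word.
(* Cancelling the first q letters leaves a flip past [x], which is shorter because q is positive. *)
have lx : wp (l :: x) = wp (x ++ [:: j]).
  apply: (mulgI (wp (alternating_word r i q))).
  rewrite -!word_prod_cat [in RHS]catA -/z [in RHS]word_prod_cat zy -word_prod_cat.
  by rewrite -iyj -xr Dl -catA.
have := IHk (a ++ alternating_word r i q) l x j b.
rewrite -!catA cat1s -[(l :: x) ++ b]cat1s Dl -!catA in red_ri * => ->.
- by rewrite mulrA -exprD szxy.
- rewrite -ltnS (leq_trans _ lty) // ltnS /= -szxy -[X in (X < _)%N]add0n.
  by rewrite ltn_add2r -ltnS -Dm.
- exact: lx.
by move: red_ri.
Qed.

Section FlipConnectivity.

(** Elements of [T] are positions: an occurrence is a list of positions and not of letters, so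
    different occurrences of one word stay apart. [f] is any quantity that flips preserve. *)
Variables (T : eqType) (letter : T -> 'I_n) (E : Type) (f : seq T -> E).
Variable P : seq T.
Hypothesis f_flip : forall q a y b w,
  subseq (q ++ a :: y ++ w) P -> subseq (q ++ y ++ b :: w) P -> a != b ->
  wp (map letter (a :: y)) = wp (map letter (y ++ [:: b])) ->
  reduced_w0 s (map letter (q ++ a :: y ++ w)) ->
  f (q ++ a :: y ++ w) = f (q ++ y ++ b :: w).

(* Knutson--Miller vertex decomposition with respect to the first position. *)
Lemma flip_connected : uniq P -> forall X Y, subseq X P -> subseq Y P ->
  reduced_w0 s (map letter X) -> reduced_w0 s (map letter Y) -> f X = f Y.
Proof.
(* [q] collects the positions already chosen in both occurrences, [L] the positions still to be
   decided. *)
suff H q L : uniq (q ++ L) -> subseq (q ++ L) P -> forall X Y, subseq X L -> subseq Y L ->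
    reduced_w0 s (map letter (q ++ X)) -> reduced_w0 s (map letter (q ++ Y)) ->
    f (q ++ X) = f (q ++ Y).
  by move=> uP X Y XP YP; apply: (H [::] P).
elim: L q => [|a L IHL] q.
  by move=> _ _ X Y; rewrite !subseq0 => /eqP-> /eqP->.
move=> uqL subP.
have IHa X Y : subseq X L -> subseq Y L ->
    reduced_w0 s (map letter (q ++ a :: X)) ->
    reduced_w0 s (map letter (q ++ a :: Y)) -> f (q ++ a :: X) = f (q ++ a :: Y).
  move=> XL YL; have := IHL (q ++ [:: a]); rewrite -!catA => /(_ uqL subP X Y XL YL).
  by rewrite -!catA.
have uqL' : uniq (q ++ L).
  by apply: subseq_uniq uqL; rewrite subseq_cat2l; apply: subseq_cons.
have subP' : subseq (q ++ L) P.
  by apply: subseq_trans subP; rewrite subseq_cat2l; apply: subseq_cons.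
have {}IHL := IHL q uqL' subP'.
have aL : a \notin L by move: uqL; rewrite cat_uniq /= => /and4P[].
(* Only one of the two occurrences uses [a]. Exchange trades some position of [X] for [a], which is
   a single flip, and the result is compared with [Y] by induction. *)
have mixed X Y : subseq X L -> subseq Y L -> reduced_w0 s (map letter (q ++ X)) ->
    reduced_w0 s (map letter (q ++ a :: Y)) -> f (q ++ X) = f (q ++ a :: Y).
  move=> XL YL redX redY.
  have wXY : wp (map letter X) = wp (map letter (a :: Y)).
    move: redX redY => /andP[_ /eqP DX] /andP[_ /eqP]; rewrite -DX.
    by rewrite !map_cat !word_prod_cat => /mulgI.
  have red_aY : reduced (map letter (a :: Y)).
    by move: redY; rewrite map_cat => /reduced_w0_reduced/reduced_catr.
  have [k] := left_exchange red_aY wXY; rewrite size_map => ltk.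
  rewrite -map_take -map_drop -map_cat => Dk.
  have X3L : subseq (take k X ++ drop k.+1 X) L.
    apply: subseq_trans XL; rewrite -[X in subseq _ X](cat_take_drop k) subseq_cat2l.
    by rewrite -addn1 addnC -drop_drop drop_subseq.
  have red3 : reduced_w0 s (map letter (q ++ a :: take k X ++ drop k.+1 X)).
    rewrite -(@reduced_w0_eq (map letter (q ++ X))) //.
      by rewrite ![map letter (q ++ _)]map_cat !(word_prod_cat (map letter q)) -Dk.
    by rewrite !size_map !size_cat -(size_delete ltk) /= size_cat.
  rewrite -(IHa (take k X ++ drop k.+1 X) Y) //.
  have [b Db] : exists b, X = take k X ++ b :: drop k.+1 X.
    by case: X ltk {XL redX wXY Dk X3L red3} => // b X ltk; exists (nth b (b :: X) k);
       rewrite -drop_nth // cat_take_drop.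
  rewrite {1}Db; apply/esym/f_flip; rewrite -?Db //.
  - by apply: subseq_trans subP; rewrite subseq_cat2l /= eqxx.
  - by apply: subseq_trans subP'; rewrite subseq_cat2l.
  - apply: contraNneq aL => ->; apply: (mem_subseq XL).
    by rewrite Db mem_cat mem_head orbT.
  have DX : X = (take k X ++ [:: b]) ++ drop k.+1 X by rewrite -catA.
  move: Dk; rewrite [in RHS]DX !(map_cat _ _ (drop _ _)) -cat_cons.
  by rewrite !(word_prod_cat _ (map letter (drop _ _))) => /mulIg.
have subCons Z : subseq Z (a :: L) -> subseq Z L \/ exists2 Z', Z = a :: Z' & subseq Z' L.
  case: Z => [|c Z] /=; first by left; apply: sub0seq.
  by case: eqP => [-> ZL|_]; [right; exists Z | left].
move=> X Y /subCons[XL|[X' -> XL]] /subCons[YL|[Y' -> YL]] redX redY.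
- exact: IHL.
- exact: mixed.
- exact/esym/mixed.
exact: IHa.
Qed.

End FlipConnectivity.

End TSign.

End CoxeterWords.
(** * Determinants of column lists *)

Section ColumnLists.

Variables (K : comNzRingType) (T : Type) (t0 : T).

(** Columns are given by a list, so that flips and sorting become rearrangements of
    concatenations. *)
Definition col_det (k : nat) (f : 'I_k -> T -> K) (cs : seq T) : K :=
  \det (\matrix_(i < k, j < k) f i (nth t0 cs j)).

Lemma col_det_swap k (f : 'I_k -> T -> K) q a b w :
    size (q ++ a :: b :: w) = k ->
  col_det f (q ++ a :: b :: w) = - col_det f (q ++ b :: a :: w).
Proof.
move=> szk.
have ltk1 : ((size q).+1 < k)%N by rewrite -szk size_cat /= !addnS ltnS ltnS leq_addr.
pose i1 := Ordinal ltk1; pose i0 := Ordinal (ltnW ltk1).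
rewrite /col_det; set M := (M in _ = - \det M).
suff -> : \matrix_(i, j) f i (nth t0 (q ++ a :: b :: w) j) = xcol i0 i1 M.
  rewrite xcolE det_mulmx [tperm_mx _ _]/perm_mx det_perm odd_tperm.
  by rewrite (_ : i0 != i1) ?mulrN1 // -val_eqE /= ltn_eqF.
apply/matrixP => i j; rewrite !mxE; congr (f i _).
case: tpermP => [->|->|/eqP jn0 /eqP jn1] /=.
- by rewrite !nth_cat ltnn subnn ltnNge leqnSn /= subSnn.
- by rewrite !nth_cat ltnn subnn ltnNge leqnSn /= subSnn.
rewrite -!val_eqE /= in jn0 jn1; rewrite !nth_cat.
case: ltnP => // leqj.
have : (1 < j - size q)%N.
  by rewrite ltn_subRL addn1 ltn_neqAle eq_sym jn1 ltn_neqAle eq_sym jn0.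
by case: (j - size q)%N => [|[|l]].
Qed.

Lemma col_det_move k (f : 'I_k -> T -> K) q a y w :
    size (q ++ a :: y ++ w) = k ->
  col_det f (q ++ a :: y ++ w) = (-1) ^+ size y * col_det f (q ++ y ++ a :: w).
Proof.
elim: y q => [|b y IHy] q szk; first by rewrite mul1r.
rewrite /= col_det_swap // exprS mulN1r mulNr -!(cat_rcons b) IHy //.
by rewrite -szk !size_cat size_rcons /= addSnnS.
Qed.

Lemma col_det_dup k (f : 'I_k -> T -> K) cs (i j : 'I_k) :
  i != j -> nth t0 cs i = nth t0 cs j -> col_det f cs = 0.
Proof.
move=> ij eqij; rewrite /col_det -det_tr; apply: (determinant_alternate ij) => l.
by rewrite !mxE eqij.
Qed.

End ColumnLists.

Section BlockDeterminant.

Variables (K : comNzRingType) (A : Type) (T : Type) (a0 : A) (t0 : T).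
Variable g : A -> T -> K.

Definition row_col_det (k : nat) (rows : seq A) (cols : seq T) : K :=
  \det (\matrix_(i < k, j < k) g (nth a0 rows i) (nth t0 cols j)).

(** The upper right block vanishes, so the matrix is block lower triangular. *)
Lemma row_col_det_cat k1 k2 r1 r2 c1 c2 :
    size r1 = k1 -> size c1 = k1 ->
    (forall i j, (i < k1)%N -> (j < k2)%N -> g (nth a0 r1 i) (nth t0 c2 j) = 0) ->
  row_col_det (k1 + k2) (r1 ++ r2) (c1 ++ c2) =
  row_col_det k1 r1 c1 * row_col_det k2 r2 c2.
Proof.
move=> szr szc g0; rewrite /row_col_det -[LHS]/(\det _).
set M := \matrix_(i, j) _.
rewrite -(submxK M) (_ : ursubmx M = 0) ?det_lblock.
  congr (_ * _); congr (\det _); apply/matrixP => i j; rewrite !mxE /= !nth_cat.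
    by rewrite szr szc !ltn_ord.
  by rewrite szr szc !ltnNge !leq_addr /= !addKn.
apply/matrixP => i j; rewrite !mxE /= !nth_cat szr szc ltn_ord.
by rewrite ltnNge leq_addr /= addKn g0.
Qed.

Lemma row_col_det_flatten (I : eqType) (L : seq I) (rows : I -> seq A)
    (cols : I -> seq T) :
    uniq L ->
    (forall i, i \in L -> size (rows i) = size (cols i)) ->
    (forall i j k l, i != j -> (k < size (rows i))%N -> (l < size (cols j))%N ->
       g (nth a0 (rows i) k) (nth t0 (cols j) l) = 0) ->
  row_col_det (size (flatten [seq cols i | i <- L]))
    (flatten [seq rows i | i <- L]) (flatten [seq cols i | i <- L]) =
  \prod_(i <- L) row_col_det (size (cols i)) (rows i) (cols i).
Proof.
move=> + + g0; elim: L => [|i L IHL] /= uL sz.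
  by rewrite big_nil /row_col_det det_mx00.
have /andP[iL uL'] := uL; have szi := sz i (mem_head _ _).
rewrite size_cat big_cons row_col_det_cat //; last first.
  move=> k l ltk; elim: L l iL {IHL uL sz uL'} => //= j L IHL l.
  rewrite inE negb_or => /andP[ij iL]; rewrite size_cat nth_cat.
  case: (ltnP l (size (cols j))) => [ltl _|lel ltl]; first by apply: g0; rewrite // szi.
  by apply: IHL; rewrite // ltn_subLR.
by rewrite IHL // => j jL; apply: sz; rewrite inE jL orbT.
Qed.

End BlockDeterminant.

Section CauchyBinet.

Variables (K : comNzRingType) (N : nat) (I : finType).
Variables (A : 'I_N -> I -> K) (C : I -> 'I_N -> K) (i0 : I).

(** Multilinear expansion gives a sum over all maps [f] from columns to [I]. Maps that repeat a
    value contribute 0; injective maps with image [z] are the permutations of its increasing listing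
    and add up to the second determinant. *)
Lemma cauchy_binet :
  \det (\matrix_(i < N, j < N) \sum_c A i c * C c j) =
  \sum_(z : {set I} | #|z| == N)
    \det (\matrix_(i < N, j < N) A i (nth i0 (enum z) j)) *
    \det (\matrix_(i < N, j < N) C (nth i0 (enum z) i) j).
Proof.
pose DA (f : {ffun 'I_N -> I}) := \det (\matrix_(i, j) A i (f j)).
have -> : \det (\matrix_(i, j) \sum_c A i c * C c j) =
    \sum_(f : {ffun 'I_N -> I}) DA f * \prod_j C (f j) j.
  rewrite -det_tr /DA; under [RHS]eq_bigr => f _ do rewrite -det_tr mulr_suml.
  rewrite exchange_big; apply: eq_bigr => /= sg _.
  under eq_bigr => j _ do rewrite !mxE.
  rewrite bigA_distr_bigA mulr_sumr; apply: eq_bigr => f _.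
  rewrite -mulrA -big_split; congr (_ * _); apply: eq_bigr => j _.
  by rewrite !mxE.
rewrite (bigID (fun f : {ffun 'I_N -> I} => injectiveb f)) /= addrC big1 ?add0r.
  2: { move=> f /injectivePn[i [j ij fij]].
       rewrite /DA -det_tr (determinant_alternate ij) ?mul0r // => l.
       by rewrite !mxE fij. }
rewrite (partition_big (fun f : {ffun 'I_N -> I} => f @: 'I_N)
  (fun z : {set I} => #|z| == N)) /=; last first.
  by move=> f /injectiveP injf; rewrite card_imset // card_ord.
apply: eq_bigr => z /eqP szz.
have szE : size (enum z) = N by rewrite -cardE.
pose e (j : 'I_N) := nth i0 (enum z) j.
have e_inj : injective e.
  move=> i j /eqP; rewrite nth_uniq ?szE ?enum_uniq // => /eqP; exact: val_inj.
pose h (sg : 'S_N) := [ffun j => e (sg j)].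
have h_inj : injective h.
  move=> s1 s2 /ffunP eqh; apply/permP => j; apply: e_inj.
  by have := eqh j; rewrite !ffunE.
rewrite (eq_bigl (mem (h @: [set: 'S_N]))); last first.
  move=> f; apply/andP/imsetP => [[/injectiveP injf /eqP fz]|[sg _ ->]].
    have fz' j : f j \in enum z by rewrite mem_enum -fz imset_f.
    have lt_ix j : (index (f j) (enum z) < N)%N by move: (fz' j); rewrite -index_mem szE.
    have ix_inj : injective (fun j => Ordinal (lt_ix j)).
      move=> i j [] eqij; apply: injf.
      by rewrite -(nth_index i0 (fz' i)) eqij nth_index.
    exists (perm ix_inj); rewrite ?inE //.
    by apply/ffunP => j; rewrite ffunE permE /e nth_index.
  have injh : injective (h sg).
    by move=> i j; rewrite !ffunE => /e_inj/perm_inj.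
  split; first exact/injectiveP.
  rewrite eqEcard card_imset // card_ord szz leqnn andbT.
  apply/subsetP => c /imsetP[j _ ->]; rewrite ffunE -mem_enum mem_nth //.
  by rewrite szE.
rewrite big_imset /=; last by move=> ? ? _ _ /h_inj.
rewrite -[\det (\matrix_(i, j) C _ _)]det_tr mulr_sumr.
apply: eq_big => [sg|sg _]; first by rewrite inE.
rewrite mulrA; congr (_ * _); last first.
  by apply: eq_bigr => j _; rewrite !mxE ffunE.
rewrite /DA -det_tr -[\det (\matrix_(i, j) A _ _) in RHS]det_tr mulrC.
rewrite -det_perm -det_mulmx -row_permE.
by congr (\det _); apply/matrixP => i j; rewrite !mxE ffunE.
Qed.

End CauchyBinet.

(** * The S-sign as the sign of sorting columns by letter *)

Fixpoint inversion_count (w : seq nat) : nat :=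
  if w is a :: w' then count (fun b => b < a)%N w' + inversion_count w' else 0%N.

Lemma inversion_countE w :
  inversion_count w =
  (\sum_(a < size w) \sum_(b < size w) ((a < b) && (nth 0 w b < nth 0 w a)))%N.
Proof.
elim: w => [|a w IHw] /=; first by rewrite big_ord0.
rewrite big_ord_recl IHw; congr (_ + _)%N.
  rewrite -sum1_count (big_nth 0%N) big_mkord big_mkcond big_ord_recl /= add0n.
  by apply: eq_bigr => b _; case: (_ < _)%N.
by apply: eq_bigr => i _; rewrite big_ord_recl add0n; apply: eq_bigr.
Qed.

Lemma inv_number_count n N (v : N.-tuple 'I_n) :
  inv_number v = inversion_count [seq val i | i <- v].
Proof.
rewrite inversion_countE /inv_number -sum1dep_card big_mkcond /=.
rewrite size_map size_tuple pair_bigA /=; apply: eq_bigr => -[a b] _ /=.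
have nthv (c : 'I_N) : nth 0%N [seq val i | i <- v] c = tnth v c.
  by rewrite (nth_map (tnth v c)) ?size_tuple // -tnth_nth.
by rewrite !nthv; case: (_ && _).
Qed.

Section SortColumns.

Variables (K : comNzRingType) (T : Type) (t0 : T) (n : nat) (key : T -> 'I_n).

(** This sort is stable: columns with the same letter keep their order, so each letter later gets
    its own block with positions in increasing order. *)
Definition sort_by_key (c : seq T) : seq T :=
  flatten [seq [seq t <- c | key t == i] | i <- enum 'I_n].

Lemma size_flatten_filter (L : seq 'I_n) (c : seq T) : uniq L ->
  size (flatten [seq [seq t <- c | key t == i] | i <- L]) =
  count (fun t => key t \in L) c.
Proof.
elim: L => [|i L IHL] /=; first by elim: c.
case/andP=> iL uL; rewrite size_cat IHL // size_filter.
elim: c {IHL} => //= t c <-; rewrite inE addnACA; congr (_ + _)%N.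
by case: eqP => [->|_] //=; rewrite (negbTE iL).
Qed.

Lemma enum_ord_split (i : 'I_n) : exists L1 L2,
  [/\ enum 'I_n = L1 ++ i :: L2, uniq L1, i \notin L1, i \notin L2
    & forall j, (j \in L1) = (j < i)%N].
Proof.
have szE := size_enum_ord n; have lti : (i < size (enum 'I_n))%N by rewrite szE.
have DE : enum 'I_n = take i (enum 'I_n) ++ i :: drop i.+1 (enum 'I_n).
  by rewrite -{2}(nth_ord_enum i i) -drop_nth // cat_take_drop.
have := enum_uniq 'I_n; rewrite {1}DE cat_uniq /= negb_or => /and4P[u1 /andP[i1 _] i2 _].
exists (take i (enum 'I_n)), (drop i.+1 (enum 'I_n)); split => // j.
by rewrite -(mem_map val_inj) map_take val_enum_ord take_iota mem_iota /=
  (minn_idPl _) ?(ltnW (ltn_ord i)).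
Qed.

(* Inserting a column in front of the sorted remaining ones moves it past the
   columns of smaller key. *)
Lemma col_det_sort k (f : 'I_k -> T -> K) q c : size (q ++ c) = k ->
  col_det t0 f (q ++ c) =
  (-1) ^+ inversion_count [seq val (key t) | t <- c] *
  col_det t0 f (q ++ sort_by_key c).
Proof.
elim: c q => [|t c IHc] q szk.
  rewrite mul1r; congr (col_det _ _ (_ ++ _)); rewrite /sort_by_key.
  by elim: (enum _).
rewrite -cat_rcons IHc ?cat_rcons //= count_map addnC exprD -mulrA; congr (_ * _).
have [L1 [L2 [DE u1 i1 i2 mem1]]] := enum_ord_split (key t).
pose F c i := [seq t <- c | key t == i].
have F_cons L : key t \notin L -> map (F (t :: c)) L = map (F c) L.
  by move=> iL; apply/eq_in_map => i jL; rewrite /F /=; case: eqP jL iL => // -> ->.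
have Dc : sort_by_key c = flatten (map (F c) L1) ++ F c (key t) ++ flatten (map (F c) L2).
  by rewrite /sort_by_key DE map_cat flatten_cat.
have Dtc : sort_by_key (t :: c) =
    flatten (map (F c) L1) ++ t :: F c (key t) ++ flatten (map (F c) L2).
  rewrite /sort_by_key -/(F _) DE map_cat flatten_cat /= -/(F _) !F_cons //.
  by rewrite /F /= eqxx.
rewrite Dc Dtc col_det_move ?(size_flatten_filter _ u1).
  by congr (_ ^+ _ * _); apply: eq_count => t' /=; rewrite mem1.
rewrite -Dc size_cat /= -szk size_cat /=; congr (_ + _.+1)%N.
rewrite size_flatten_filter ?enum_uniq // -[RHS]count_predT; apply: eq_count => t'.
by rewrite mem_enum.
Qed.

End SortColumns.
(** * Schur functions as minors *)

Section SchurDeterminants.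

Variables (R : realType) (n N d : nat).

Lemma enum_filter (T : finType) (A : {set T}) : enum A = [seq x <- enum T | x \in A].
Proof. by rewrite enumT. Qed.

Lemma sorted_enum_val k (A : {set 'I_k}) : sorted ltn (map val (enum A)).
Proof.
have : sorted ltn (map val (enum 'I_k)) by rewrite val_enum_ord iota_ltn_sorted.
apply: subseq_sorted; first exact: ltn_trans.
by apply: map_subseq; rewrite enum_filter filter_subseq.
Qed.

Lemma nth_enum_ltn k (A : {set 'I_k}) (x0 : 'I_k) a b : (a < b)%N -> (b < #|A|)%N ->
  (nth x0 (enum A) a < nth x0 (enum A) b)%N.
Proof.
rewrite cardE => ltab ltb; have lta := ltn_trans ltab ltb.
have := path.sorted_ltn_nth ltn_trans 0%N (sorted_enum_val A).
by move=> /(_ a b); rewrite !inE size_map !(nth_map x0) //; apply.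
Qed.

(** The lexicographic order lists pairs letter by letter, which provides the row blocks of the
    determinant. *)
Lemma enum_pair_set (z : {set 'I_n * 'I_d}) :
  enum z = flatten [seq [seq (i, k) | k <- enum [set k | (i, k) \in z]] | i <- enum 'I_n].
Proof.
have -> : enum z = [seq c <- prod_enum 'I_n 'I_d | c \in z].
  by rewrite enum_filter; congr filter; rewrite enumT unlock.
rewrite /prod_enum; elim: (enum 'I_n) => //= i L IHL.
rewrite filter_cat IHL; congr (_ ++ _); rewrite filter_map; congr map.
by rewrite [RHS]enum_filter; apply: eq_filter => k; rewrite inE.
Qed.

Lemma leq_nth_sorted (t : seq nat) a :
  sorted ltn t -> (a < size t)%N -> (a <= nth 0%N t a)%N.
Proof.
move=> st; elim: a => // a IHa lta; apply: leq_ltn_trans (IHa (ltnW lta)) _.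
by apply: (path.sorted_ltn_nth ltn_trans 0%N st) => //; rewrite inE // ltnW.
Qed.

(** The shift in [column_partition] cancels against the row index. The natural subtraction is not
    truncated, since the entry at index a of a strictly increasing list of naturals is at least
    a. *)
Lemma column_exponent (z : {set 'I_n * 'I_d}) (i : 'I_n) r a :
    #|[set k | (i, k) \in z]| = r -> (a < r)%N ->
  (a + nth 0 (column_partition z i) (r - a.+1))%N =
  nth 0%N [seq val k | k <- enum [set k | (i, k) \in z]] a.
Proof.
move=> szr lta; set t := map _ _.
have szt : size t = r by rewrite size_map -cardE.
have st : sorted ltn t := sorted_enum_val _.
have ltr : (r - a.+1 < r)%N by rewrite -subSn // subSS leq_subr.
have Da : (r - (r - a.+1).+1)%N = a by rewrite -subSn // subSS subKn // ltnW.
rewrite /column_partition -/t nth_mkseq size_rev szt // nth_rev szt // Da.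
by rewrite subnKC // leq_nth_sorted // szt.
Qed.

Lemma meval_alternant (y : 'I_N -> R) (J : {set 'I_N}) e :
  meval y (alternant (fun j : 'I_#|J| => mpolyX R (mnm1 (enum_val j))) e) =
  \det (\matrix_(i < #|J|, j < #|J|) y (enum_val j) ^+ e i).
Proof.
rewrite /alternant -det_map_mx; congr (\det _); apply/matrixP => i j.
by rewrite !mxE rmorphXn /= mevalXU.
Qed.

(** The denominator is a Vandermonde determinant at increasing values. *)
Lemma schur_den_gt0 (y : 'I_N -> R) (J : {set 'I_N}) :
    (forall i j : 'I_N, i \in J -> j \in J -> (i < j)%N -> y i < y j) ->
  0 < meval y (schur_den R J).
Proof.
move=> ymono; rewrite meval_alternant.
have -> : \matrix_(i < #|J|, j < #|J|) y (enum_val j) ^+ i =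
    Vandermonde #|J| (\row_j y (enum_val j)).
  by apply/matrixP => i j; rewrite !mxE.
rewrite det_Vandermonde; apply: prodr_gt0 => i _; apply: prodr_gt0 => j ltij.
rewrite !mxE subr_gt0; apply: ymono; rewrite ?enum_valP //.
by have j0 := enum_val i; rewrite !(enum_val_nth j0) nth_enum_ltn.
Qed.

Lemma schur_mul_den (lam : seq nat) (J : {set 'I_N}) :
  schur R lam J * schur_den R J = schur_num R lam J.
Proof. exact/eqP/(xchooseP (schur_exists R lam J)). Qed.

(** Entries vanish unless row and column carry the same letter. Sorting the columns by letter costs
    (-1)^inv and makes the matrix block diagonal; the block of each letter is a generalized
    Vandermonde matrix, that is, a Schur numerator. *)
Lemma column_set_det (v : N.-tuple 'I_n) (y : 'I_N -> R) (j0 : 'I_N) (c0 : 'I_n * 'I_d)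
    (z : {set 'I_n * 'I_d}) : z \in column_sets d (abelian_vector v) ->
  \det (\matrix_(i < N, j < N)
     let c := nth c0 (enum z) i in (c.1 == tnth v j)%:R * y j ^+ c.2) =
  (-1) ^+ inv_number v *
  (meval y (partial_schur R (column_partition z) (letter_positions v)) *
   \prod_(i < n) meval y (schur_den R (letter_positions v i))).
Proof.
rewrite inE => /forallP szz.
pose g (c : 'I_n * 'I_d) (j : 'I_N) : R := (c.1 == tnth v j)%:R * y j ^+ c.2.
pose rows i := [seq (i, k) | k <- enum [set k | (i, k) \in z]].
pose cols i := [seq j <- enum 'I_N | tnth v j == i].
have Dcols i : cols i = enum (letter_positions v i).
  by rewrite enum_filter; apply: eq_filter => j; rewrite inE.
have szrc i : size (rows i) = size (cols i).
  by rewrite size_map -cardE (eqP (szz i)) Dcols -cardE.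
transitivity (col_det j0 (fun i : 'I_N => g (nth c0 (enum z) i)) ([::] ++ enum 'I_N)).
  by congr (\det _); apply/matrixP => i j; rewrite !mxE nth_ord_enum.
rewrite (col_det_sort _ (tnth v)) ?size_enum_ord // (map_comp val (tnth v)).
rewrite map_tnth_enum -inv_number_count; congr (_ * _).
have szN : size (flatten [seq cols i | i <- enum 'I_n]) = N.
  rewrite size_flatten_filter ?enum_uniq // -[RHS]size_enum_ord -[RHS]count_predT.
  by apply: eq_count => j; rewrite mem_enum.
have /= := row_col_det_flatten (a0 := c0) (t0 := j0) (g := g)
  (enum_uniq 'I_n) (fun i _ => szrc i).
rewrite szN -enum_pair_set => Dg.
transitivity (row_col_det c0 j0 g N (enum z) (flatten [seq cols i | i <- enum 'I_n])).
  by [].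
rewrite Dg; last first.
  move=> i j k l ij ltk ltl; rewrite /g.
  have /mapP[k' _ ->] := mem_nth c0 ltk; have := mem_nth j0 ltl.
  by rewrite mem_filter => /andP[/eqP-> _]; rewrite (negbTE ij) mul0r.
rewrite /partial_schur rmorph_prod -big_split big_enum; apply: eq_bigr => i _.
rewrite /= -rmorphM /= schur_mul_den /schur_num meval_alternant /row_col_det.
have szJ : size (cols i) = #|letter_positions v i| by rewrite Dcols -cardE.
rewrite szJ; congr (\det _); apply/matrixP => a b; rewrite !mxE.
have lta : (a < size (enum [set k | (i, k) \in z]))%N.
  by rewrite -cardE (eqP (szz i)) ltn_ord.
have k0 : 'I_d by case: (enum _) lta => // k.
rewrite (nth_map k0) // Dcols -enum_val_nth /g /=.
have := enum_valP b; rewrite inE => /eqP->; rewrite eqxx mul1r.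
by rewrite column_exponent ?(eqP (szz i)) // (nth_map k0).
Qed.

Lemma card_column_set (v : N.-tuple 'I_n) (z : {set 'I_n * 'I_d}) :
  z \in column_sets d (abelian_vector v) -> #|z| = N.
Proof.
rewrite inE => /forallP szz; rewrite cardE enum_pair_set.
rewrite -[RHS]card_ord -[RHS]sum1_card (partition_big (tnth v) predT) //=.
rewrite size_flatten sumnE /shape -map_comp big_map big_enum; apply: eq_bigr => i _ /=.
rewrite size_map -cardE (eqP (szz i)) /abelian_vector -sum1_card.
by apply: eq_bigl => j; rewrite inE.
Qed.

(** A permutation that matches the letters of [z] with those of [v] forces equal letter counts; the
    contrapositive kills the other column sets in the Cauchy-Binet sum. *)
Lemma column_set_transport (v : N.-tuple 'I_n) (z : {set 'I_n * 'I_d})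
    (c0 : 'I_n * 'I_d) (sg : 'S_N) :
    #|z| = N -> (forall a : 'I_N, (nth c0 (enum z) a).1 = tnth v (sg a)) ->
  z \in column_sets d (abelian_vector v).
Proof.
move=> szz Dv; have szE : size (enum z) = N by rewrite -cardE.
rewrite inE; apply/forallP => i; apply/eqP; pose e (a : 'I_N) := nth c0 (enum z) a.
have e_inj : injective e.
  move=> a b /eqP; rewrite nth_uniq ?szE ?enum_uniq // => /eqP; exact: val_inj.
pose E := [set a | (e a).1 == i].
have pair_inj : injective (fun k : 'I_d => (i, k)) by move=> k l [].
transitivity #|E|; last first.
  rewrite -(card_imset _ (@perm_inj _ sg)) /abelian_vector; congr #|pred_of_set _|.
  apply/setP => j; rewrite inE; apply/imsetP/eqP => [[a aE ->]|vj].
    by move: aE; rewrite inE Dv => /eqP.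
  by exists (sg^-1 j)%g; rewrite ?permKV // inE /e Dv permKV vj.
rewrite -(card_imset _ pair_inj) -(card_imset _ e_inj); congr #|pred_of_set _|.
apply/setP => c; apply/imsetP/imsetP => [[k] | [a]].
  rewrite inE -mem_enum => kz ->; have lt_ix : (index (i, k) (enum z) < N)%N.
    by rewrite -[X in (_ < X)%N]szE index_mem.
  exists (Ordinal lt_ix); last by rewrite /e nth_index.
  by rewrite inE /e nth_index.
rewrite inE => /eqP ai ->; exists (e a).2; last by rewrite -ai; case: (e a).
by rewrite inE -ai -surjective_pairing -mem_enum mem_nth // szE.
Qed.

(* Cauchy--Binet; column sets with the wrong letter counts contribute 0. *)
Lemma det_schur_minor_sum (P : 'I_N -> 'I_n -> 'I_d -> R) (v : N.-tuple 'I_n)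
    (y : 'I_N -> R) : 'I_N -> 'I_n -> 'I_d ->
  \det (\matrix_(i < N, j < N) \sum_(k < d) P i (tnth v j) k * y j ^+ k) =
  (-1) ^+ inv_number v * (schur_minor_sum P v y *
    \prod_(i < n) meval y (schur_den R (letter_positions v i))).
Proof.
move=> j0 i0 k0; pose c0 := (i0, k0).
(* The indicator collapses the sum over all pairs to the polynomial belonging to the letter of
   column [j]. *)
pose C (c : 'I_n * 'I_d) (j : 'I_N) : R := (c.1 == tnth v j)%:R * y j ^+ c.2.
pose Q i (c : 'I_n * 'I_d) := P i c.1 c.2.
have -> : \matrix_(i < N, j < N) (\sum_(k < d) P i (tnth v j) k * y j ^+ k) =
    \matrix_(i < N, j < N) \sum_c Q i c * C c j.
  apply/matrixP => i j; rewrite !mxE.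
  rewrite -(pair_bigA _ (fun a k => Q i (a, k) * C (a, k) j)) /=.
  rewrite (bigD1 (tnth v j)) //= [X in _ + X]big1 ?addr0.
    by apply: eq_bigr => k _; rewrite /C /= eqxx mul1r.
  by move=> a /negbTE av; apply: big1 => k _; rewrite /C /= av mul0r mulr0.
rewrite (cauchy_binet _ _ c0) /schur_minor_sum mulr_suml mulr_sumr.
rewrite (bigID (fun z => z \in column_sets d (abelian_vector v))) /=.
rewrite [X in _ + X]big1 ?addr0 => [|z /andP[/eqP szz zv]]; last first.
  rewrite [X in _ * X]big1 ?mulr0 // => sg _.
  (* With wrong letter counts, every permutation meets a row and a column of different letters,
     hence a zero factor. *)
  have [a av] : exists a : 'I_N, (nth c0 (enum z) a).1 != tnth v (sg a).
    apply/existsP; apply: contraR zv; rewrite negb_exists => /forallP Dv.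
    by apply: (@column_set_transport v z c0 sg) => // a; apply/eqP;
      have := Dv a; rewrite negbK.
  by rewrite (bigD1 a) //= !mxE /C (negbTE av) !mul0r mulr0.
apply: eq_big => [z|z /andP[/eqP szz zv]].
  by case: (boolP (z \in _)) => [/card_column_set->|]; rewrite ?eqxx ?andbF.
have := column_set_det y j0 c0 zv; rewrite /= -/(C _ _) => ->.
rewrite mulrCA; congr (_ * _); rewrite !mulrA; congr (_ * _ * _).
congr (\det _); apply/matrixP => i j; rewrite !mxE.
by rewrite (nth_map c0) // -cardE szz.
Qed.

End SchurDeterminants.
(** * Signs of the Gale minors *)

Section ConeSigns.

Variables (R : realType) (N m : nat) (B : 'M[R]_(N, m)).

Definition vec_det (cs : seq 'cV[R]_N) : R :=
  col_det 0 (fun i (c : 'cV[R]_N) => c i 0) cs.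

Definition pos_det (X : seq 'I_m) : R := vec_det [seq col j B | j <- X].

Lemma vec_det_linear q w a (x y : 'cV[R]_N) : (size q + size w).+1 = N ->
  vec_det (q ++ (a *: x + y) :: w) = a * vec_det (q ++ x :: w) + vec_det (q ++ y :: w).
Proof.
move=> szN; have ltq : (size q < N)%N.
  have : (size q < (size q + size w).+1)%N by rewrite ltnS leq_addr.
  by rewrite szN.
rewrite -[vec_det (q ++ y :: w)]mul1r /vec_det /col_det -det_tr.
rewrite -[X in a * X]det_tr -[X in 1 * X]det_tr.
apply: (@determinant_multilinear _ _ _ _ _ (Ordinal ltq)).
- by apply/rowP => i; rewrite !mxE /= !nth_cat ltnn subnn /= !mxE mul1r.
- apply/matrixP => i j; rewrite !mxE /= !nth_cat.
  have := neq_lift (Ordinal ltq) i; rewrite -val_eqE /=.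
  move=> neq; case: ltnP => // leqi.
  have : (0 < bump (size q) i - size q)%N by rewrite subn_gt0 ltn_neqAle neq leqi.
  by case: (_ - _)%N.
apply/matrixP => i j; rewrite !mxE /= !nth_cat.
have := neq_lift (Ordinal ltq) i; rewrite -val_eqE /=.
move=> neq; case: ltnP => // leqi.
have : (0 < bump (size q) i - size q)%N by rewrite subn_gt0 ltn_neqAle neq leqi.
by case: (_ - _)%N.
Qed.

Lemma vec_det_dup q w (x : 'cV[R]_N) : (size q + size w).+1 = N ->
  x \in q ++ w -> vec_det (q ++ x :: w) = 0.
Proof.
move=> szN xqw.
have ltq : (size q < N)%N.
  have : (size q < (size q + size w).+1)%N by rewrite ltnS leq_addr.
  by rewrite szN.
have [j jq Dj] : exists2 j : 'I_N, Ordinal ltq != j & nth 0 (q ++ x :: w) j = x.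
  move: xqw; rewrite mem_cat => /orP[xq|xw].
    have lti : (index x q < size q)%N by rewrite index_mem.
    exists (Ordinal (ltn_trans lti ltq)); last by rewrite nth_cat lti nth_index.
    by rewrite -val_eqE /= gtn_eqF.
  have lti : (index x w < size w)%N by rewrite index_mem.
  have ltN : ((size q + index x w).+1 < N)%N.
    have : ((size q + index x w).+1 < (size q + size w).+1)%N by rewrite ltnS ltn_add2l.
    by rewrite szN.
  exists (Ordinal ltN); first by rewrite -val_eqE /= ltn_eqF // ltnS leq_addr.
  by rewrite nth_cat /= ltnNge leqW ?leq_addr //= subSn ?leq_addr // addKn /= nth_index.
apply: (col_det_dup _ jq); rewrite Dj nth_cat ltnn subnn //.
Qed.

(** On the cone, a linear form vanishing on all generators but the one at [a] is a nonnegative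
    multiple of its value there. At an interior point the multiple is positive, because a small step
    back along that generator stays in the cone. *)
Lemma interior_cone_sign (F : 'cV[R]_N -> R) (C : {set 'I_m}) (a : 'I_m) y :
    (forall t u v, F (t *: u + v) = t * F u + F v) ->
    a \notin C -> (forall j, j \notin C -> j != a -> F (col j B) = 0) ->
    interior (dual_cone B C) y ->
  exists2 t, 0 < t & F y = t * F (col a B).
Proof.
move=> Flin aC F0 /nbhs_ballP[e /= e_gt0 ballC].
have Fzero : F 0 = 0.
  by have := Flin (-1) 0 0; rewrite scaler0 addr0 mulN1r addNr.
have Fsum (c : 'I_m -> R) : F (\sum_(j in ~: C) c j *: col j B) = c a * F (col a B).
  have -> : F (\sum_(j in ~: C) c j *: col j B) = \sum_(j in ~: C) c j * F (col j B).
    by elim/big_rec2: _ => [//|j u v _ <-]; rewrite Flin.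
  rewrite (bigD1 a) ?inE //= big1 ?addr0 // => j /andP[]; rewrite inE => jC ja.
  by rewrite F0 ?mulr0.
pose S := \sum_i `|col a B i 0|.
have S_ge0 : 0 <= S by apply: sumr_ge0.
have S1_gt0 : 0 < 1 + S by rewrite ltr_pwDl.
(* Each entry of the generator is at most [S] in absolute value, so the step changes entries by at
   most t S < e; the added 1 makes this strict and the division safe. *)
pose t := e / (1 + S); have t_gt0 : 0 < t by rewrite divr_gt0.
have /ballC[c c_ge0 Dc] : ball y e (y - t *: col a B).
  split=> // i j; rewrite /ball /= !mxE opprD addNKr ?opprK.
  rewrite normrM gtr0_norm // (@le_lt_trans _ _ (t * S)) //.
    rewrite ler_pM2l // /S (bigD1 i) //= mxE lerDl sumr_ge0 //.
  by rewrite -[X in _ < X](divfK (lt0r_neq0 S1_gt0)) -/t ltr_pM2l // ltrDr.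
exists (c a + t); first by rewrite ltr_wpDl.
have -> : y = t *: col a B + (y - t *: col a B) by rewrite addrC subrK.
by rewrite Flin Dc Fsum mulrDl addrC.
Qed.

(** Moving column [a] past [u] gives the power of -1. Both determinants are then values, at the
    columns [a] and [b], of one linear form that vanishes on the shared columns; the common interior
    point gives both values the same sign. *)
Lemma flip_sign q a u b w y :
    let X1 := q ++ a :: u ++ w in let X2 := q ++ u ++ b :: w in
    size X1 = N -> a \notin X2 -> b \notin X1 ->
    interior (dual_cone B (~: [set j in X1])) y ->
    interior (dual_cone B (~: [set j in X2])) y ->
  sgz (pos_det X1) = (-1) ^+ size u * sgz (pos_det X2).
Proof.
move=> X1 X2 szX aX2 bX1 y1 y2.
have -> : pos_det X1 = (-1) ^+ size u * pos_det (q ++ u ++ a :: w).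
  rewrite /pos_det !map_cat /= map_cat /vec_det col_det_move ?size_map //.
  by apply: etrans szX; rewrite !size_cat /= !size_cat !size_map.
rewrite sgzM sgzX sgzN1; congr (_ * _).
pose F x := vec_det ([seq col j B | j <- q ++ u] ++ x :: [seq col j B | j <- w]).
have szN : (size [seq col j B | j <- q ++ u] + size [seq col j B | j <- w]).+1 = N.
  by apply: etrans szX; rewrite !size_map !size_cat /= size_cat addnS addnA.
have Flin t x z : F (t *: x + z) = t * F x + F z by apply: vec_det_linear.
have F0 j : j \in q ++ u ++ w -> F (col j B) = 0.
  by move=> jX; apply: vec_det_dup => //; rewrite -map_cat -catA; apply: map_f.
have FE j : pos_det (q ++ u ++ j :: w) = F (col j B).
  by rewrite /pos_det catA map_cat.
have in1 : a \notin ~: [set j in X1] by rewrite !inE negbK mem_cat mem_head orbT.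
have in2 : b \notin ~: [set j in X2].
  by rewrite !inE negbK !mem_cat mem_head !orbT.
have [j|t t_gt0 Dt] := interior_cone_sign Flin in1 _ y1.
  rewrite !inE negbK !mem_cat in_cons mem_cat => + /negbTE ja; rewrite ja /= => jX.
  by rewrite F0 // !mem_cat.
have [j|t' t'_gt0 Dt'] := interior_cone_sign Flin in2 _ y2.
  rewrite !inE negbK !mem_cat in_cons => + /negbTE jb; rewrite jb /= => jX.
  by rewrite F0 // !mem_cat.
rewrite !FE; have <- : sgz (F y) = sgz (F (col a B)).
  by rewrite Dt sgzM gtr0_sgz // mul1r.
by rewrite Dt' sgzM gtr0_sgz // mul1r.
Qed.

Lemma pos_det_neq0 (C : {set 'I_m}) : #|~: C| = N ->
    row_free (colsub (fun j : 'I_#|~: C| => enum_val j) B)^T ->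
  pos_det (enum (~: C)) != 0.
Proof.
move=> szC /eqP rkC; rewrite /pos_det /vec_det /col_det -det_tr -unitfE.
set M := (X in \det X); rewrite -unitmxE -row_free_unit.
rewrite /row_free eqn_leq rank_leq_row /= -[X in (X <= _)%N]szC -[X in (X <= _)%N]rkC.
apply: mxrankS; apply/row_subP => a.
have lta : (a < N)%N by rewrite -szC ltn_ord.
rewrite (_ : row a _ = row (Ordinal lta) M) ?row_sub //.
apply/rowP => i; rewrite !mxE (nth_map (enum_val a)) -?cardE; last exact: (ltn_ord a).
by rewrite -enum_val_nth mxE.
Qed.

End ConeSigns.

(** Vandermonde interpolation, padded by a zero top coefficient so that the number of coefficients
    is positive even for m = 0. *)
Lemma interpolation (F : fieldType) m (x b : 'I_m -> F) : injective x ->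
  exists Q : 'I_m.+1 -> F, forall j, \sum_k Q k * x j ^+ k = b j.
Proof.
move=> x_inj; pose V := Vandermonde m (\row_j x j).
have V_unit : V \in unitmx.
  rewrite unitmxE unitfE det_Vandermonde prodf_seq_neq0; apply/allP => i _ /=.
  rewrite prodf_seq_neq0; apply/allP => j _ /=; apply/implyP => ltij.
  by rewrite !mxE subr_eq0 (inj_eq x_inj) -val_eqE gtn_eqF.
pose u := \row_j b j *m invmx V.
exists (fun k => oapp (u 0) 0 (insub (val k))) => j.
rewrite big_ord_recr /= insubN ?ltnn //= mul0r addr0.
have /rowP/(_ j) : u *m V = \row_j b j by rewrite mulmxKV.
by rewrite !mxE => <-; apply: eq_bigr => k _; rewrite valK /= !mxE.
Qed.

(** * Signs of the minors at all occurrences *)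

Section Chirotope.

Variables (R : realType) (n : nat) (W : finGroupType) (s : 'I_n -> W).
Variables (tau : seq 'I_n -> int) (m : nat) (p : m.-tuple 'I_n).

(** All occurrences have the same number of positions, so the complement of one is never strictly
    contained in the complement of another. *)
Lemma occurrence_facet (Z : {set 'I_m}) :
  reduced_w0 s (subword p Z) -> facet (subword_complex s p) (~: Z).
Proof.
move=> redZ; apply/maxsetP; split.
  by rewrite /= inE; apply/existsP; exists (~: Z); rewrite setCK redZ subxx.
have card_occ Y : reduced_w0 s (subword p Y) -> #|Y| = longest_length s.
  by case/andP; rewrite size_map -cardE => /eqP.
move=> F; rewrite /= inE => /existsP[C /andP[/card_occ szC FC]] ZF.
apply/esym/eqP; rewrite eqEcard ZF (leq_trans (subset_leq_card FC)) //.
by rewrite -[C]setCK cardsCs !setCK szC [X in (_ <= X)%N]cardsCs setCK card_occ.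
Qed.

Lemma enum_set_subseq (X : seq 'I_m) : subseq X (enum 'I_m) -> enum [set j in X] = X.
Proof.
move=> sX; rewrite enum_filter (subseq_uniqP (enum_uniq 'I_m) sX).
by apply: eq_filter => j; rewrite inE mem_filter mem_enum andbT.
Qed.

(** The product [f] of the sign of the minor and [tau] is preserved by flips, since both factors
    change by the same power of -1. Connectivity makes it constant, and [c] records its value. *)
Lemma chirotope_sign (A : 'M[R]_(m - longest_length s, m)) :
    coxeter_system s -> T_sign s tau ->
    chirotopal_realization (subword_complex s p) A ->
  exists (B : 'M[R]_(longest_length s, m)) (c : bool),
    forall Z : {set 'I_m}, reduced_w0 s (subword p Z) ->
      sgz (pos_det B (enum Z)) = (-1) ^+ c * tau (subword p Z).
Proof.
move=> cox Htau [_ [B [_ Bfree Bflip]]]; exists B.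
pose occ X := reduced_w0 s (map (tnth p) X).
have facetX X : subseq X (enum 'I_m) -> occ X ->
    facet (subword_complex s p) (~: [set j in X]).
  by move=> sX redX; apply: occurrence_facet; rewrite /subword enum_set_subseq.
have sizeX X : occ X -> size X = longest_length s.
  by case/andP; rewrite size_map => /eqP.
pose f X : int := sgz (pos_det B X) * tau (map (tnth p) X).
have f_flip q a y b w : subseq (q ++ a :: y ++ w) (enum 'I_m) ->
    subseq (q ++ y ++ b :: w) (enum 'I_m) -> a != b ->
    word_prod s (map (tnth p) (a :: y)) = word_prod s (map (tnth p) (y ++ [:: b])) ->
    occ (q ++ a :: y ++ w) -> f (q ++ a :: y ++ w) = f (q ++ y ++ b :: w).
  set X1 := q ++ a :: y ++ w; set X2 := q ++ y ++ b :: w.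
  move=> s1 s2 ab wab red1.
  have Dtau : tau (map (tnth p) X1) = (-1) ^+ size y * tau (map (tnth p) X2).
    have wab' := wab; rewrite /= map_cat in wab'.
    have := red1; rewrite /occ /X1 map_cat /= map_cat => red1'.
    rewrite (T_sign_flip cox Htau wab') // size_map.
    by rewrite /X2 !map_cat -catA.
  have red2 : occ X2.
    have DX2 : map (tnth p) X2 =
        map (tnth p) q ++ map (tnth p) (y ++ [:: b]) ++ map (tnth p) w.
      by rewrite /X2 !map_cat -catA.
    rewrite /occ DX2 -(reduced_w0_replace _ _ wab).
      by have := red1; rewrite /occ /X1 map_cat /= map_cat.
    by rewrite !size_map size_cat addn1.
  have u1 := subseq_uniq s1 (enum_uniq _); have u2 := subseq_uniq s2 (enum_uniq _).
  have aX2 : a \notin X2.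
    move: u1; rewrite /X1 /X2 uniq_catC /= !mem_cat in_cons (negbTE ab) /=.
    by case/andP => + _; rewrite !negb_or => /andP[/andP[-> ->] ->].
  have bX1 : b \notin X1.
    move: u2; rewrite /X1 /X2 catA uniq_catC /= !mem_cat in_cons !mem_cat.
    rewrite eq_sym (negbTE ab) /=.
    by case/andP => + _; rewrite !negb_or => /andP[-> /andP[-> ->]].
  (* The two facets meet in either one with a single position removed, which is a ridge, so
     condition (F) applies. *)
  have DI : ~: [set j in X1] :&: ~: [set j in X2] = ~: [set j in X1] :\ b.
    apply/setP => j; rewrite !inE !mem_cat !in_cons !mem_cat.
    by case: (j \in q); case: (j \in y); case: (j \in w); case: (j == a);
      case: (j == b).
  have DI' : ~: [set j in X1] :&: ~: [set j in X2] = ~: [set j in X2] :\ a.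
    apply/setP => j; rewrite !inE !mem_cat !in_cons !mem_cat.
    by case: (j \in q); case: (j \in y); case: (j \in w); case: (j == a);
      case: (j == b).
  have ridge : share_ridge (~: [set j in X1]) (~: [set j in X2]).
    split; first by rewrite DI [RHS](cardsD1 b) !inE bX1.
    by rewrite DI' [RHS](cardsD1 a) !inE aX2.
  have [z [z1 z2]] := Bflip _ _ (facetX _ s1 red1) (facetX _ s2 red2) ridge.
  rewrite /f Dtau (flip_sign (sizeX _ red1) aX2 bX1 z1 z2) mulrACA -exprD.
  by rewrite addnn -mul2n exprM sqrrN expr1n mul1r.
have f_const := flip_connected cox f_flip (enum_uniq _).
have sEnum (Z : {set 'I_m}) : subseq (enum Z) (enum 'I_m).
  by rewrite enum_filter filter_subseq.
(* Condition (B) makes the minor nonzero, so [f] takes only the values 1 and -1. *)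
have f_sign Z : reduced_w0 s (subword p Z) -> exists c : bool, f (enum Z) = (-1) ^+ c.
  move=> redZ; have := occurrence_facet redZ => /Bfree/pos_det_neq0; rewrite setCK.
  case/andP: (redZ); rewrite size_map -cardE => /eqP szZ _ /(_ szZ) detZ.
  rewrite /f; case: (T_sign_pm1 Htau redZ) => ->.
    by case: sgzP detZ => // _ _; [exists false|exists true].
  by case: sgzP detZ => // _ _; [exists true|exists false].
(* Without occurrences the claim is vacuous and any [c] will do. *)
case: (pickP (fun Z => reduced_w0 s (subword p Z))) => [Z0 red0|no_occ]; last first.
  by exists false => Z; rewrite no_occ.
have [c Dc] := f_sign Z0 red0; exists c => Z redZ.
have DZ : f (enum Z) = (-1) ^+ c by rewrite -Dc; apply: f_const.
rewrite -DZ /f -/(subword p Z) -mulrA.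
by case: (T_sign_pm1 Htau redZ) => ->; rewrite ?mulrNN !mulr1.
Qed.

End Chirotope.

(** * The parameter tensor and the points x_i *)

Theorem theorem3 (R : realType) (n : nat) (W : finGroupType) (s : 'I_n -> W)
    (tau : seq 'I_n -> int) (m : nat) (p : m.-tuple 'I_n)
    (A : 'M[R]_(m - longest_length s, m)) :
  coxeter_system s ->
  coxeter_irreducible s ->
  T_sign s tau ->
  chirotopal_realization (subword_complex s p) A ->
  exists (d : nat) (P : 'I_(longest_length s) -> 'I_n -> 'I_d -> R)
         (x : 'I_m -> R),
    [/\ (0 < d)%N,
        forall i, 0 < x i,
        forall i j : 'I_m, (i < j)%N -> tnth p i = tnth p j -> x i < x j
      & forall (v : (longest_length s).-tuple 'I_n) (Z : {set 'I_m}),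
          reduced_w0 s v -> subword p Z = v ->
          sgz (schur_minor_sum P v
                 (fun j => nth 0 [seq x i | i <- enum Z] j))
          = S_sign v * tau v].
Proof.
move=> cox [n_gt0 _] Htau chiA.
have [B [c signB]] := chirotope_sign cox Htau chiA.
set N := longest_length s in A chiA B signB *.
have N_gt0 : (0 < N)%N := longest_length_gt0 cox n_gt0.
pose i0 := Ordinal N_gt0.
(* These values are distinct over all positions, not merely those sharing a letter, so one
   polynomial interpolates a whole row of [B]. *)
pose x (i : 'I_m) : R := (val i).+1%:R.
have x_mono (i j : 'I_m) : (x i < x j) = (i < j)%N by rewrite ltr_nat.
have x_inj : injective x.
  by move=> i j /eqP; rewrite eqr_nat eqSS => /eqP/val_inj.
(* Only the first row is scaled by (-1)^c, which multiplies every maximal minor by the global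
   sign. *)
pose e (i : 'I_N) : R := (-1) ^+ ((i == i0) && c).
have /fin_all_exists[Q DQ] i := interpolation (fun j => e i * B i j) x_inj.
(* Every letter receives the same interpolating polynomial in a given row. *)
exists m.+1, (fun i _ => Q i), x; split=> // [i j ltij _|v Z redv Dv].
  by rewrite x_mono.
set y := fun j : 'I_N => _.
have szZ : size (enum Z) = N.
  by rewrite -(size_map (tnth p)) -/(subword p Z) Dv size_tuple.
have m_gt0 : (0 < m)%N.
  by apply: (leq_trans N_gt0); have := max_card Z; rewrite card_ord cardE szZ.
pose k0 := Ordinal m_gt0; pose z (j : 'I_N) := nth k0 (enum Z) j.
have yE j : y j = x (z j) by rewrite /y (nth_map k0) ?szZ.
have z_mono (i j : 'I_N) : (i < j)%N -> (z i < z j)%N.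
  by move=> ltij; apply: nth_enum_ltn; rewrite // cardE szZ.
have den_gt0 : 0 < \prod_(i < n) meval y (schur_den R (letter_positions v i)).
  apply: prodr_gt0 => i _; apply: schur_den_gt0 => a b _ _ ltab.
  by rewrite !yE x_mono z_mono.
have detE : \det (\matrix_(i < N, j < N) \sum_(k < m.+1) Q i k * y j ^+ k) =
    (-1) ^+ c * pos_det B (enum Z).
  have -> : \matrix_(i < N, j < N) (\sum_(k < m.+1) Q i k * y j ^+ k) =
      diag_mx (\row_i e i) *m \matrix_(i < N, j < N) B i (z j).
    by apply/matrixP => i j; rewrite mul_diag_mx !mxE yE DQ.
  rewrite det_mulmx det_diag (bigD1 i0) //= big1 ?mulr1 => [|i /negbTE ii0].
    rewrite mxE /e eqxx /=; congr (_ * \det _); apply/matrixP => i j.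
    by rewrite !mxE (nth_map k0) ?szZ // mxE.
  by rewrite mxE /e ii0.
have := det_schur_minor_sum (fun i (_ : 'I_n) => Q i) v y i0 (Ordinal n_gt0) ord0.
rewrite detE => /(congr1 (fun r : R => sgz r)) /=.
(* The two factors (-1)^c cancel, the Vandermonde denominators are positive, and the S-sign, being
   its own inverse, moves to the other side. *)
rewrite !sgzM !sgzX !sgzN1 (gtr0_sgz den_gt0) mulr1 signB ?Dv // signrMK.
by rewrite /S_sign => ->; rewrite signrMK.
Qed.
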